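(* For every integer $k\ge 2$ there is a constant $B_k$ such that for every graph $G$ on $p$ vertices with $m$ edges and no isolated vertices, \[ r(C_{2k+1},G)\le 2m\left(1+B_k m^{-1/20}\right)+p. \]
   Context: For graphs $H$ and $G$, the Ramsey number $r(H,G)$ is the least positive integer $N$ such that every red/blue coloring of the edges of the complete graph $K_N$ contains a red copy of $H$ or a blue copy of $G$. $C_{2k+1}$ denotes the cycle on $2k+1$ vertices. *)

(* Defs.v *)
From mathcomp Require Import all_boot.

Set Implicit Arguments.
Unset Strict Implicit.
Unset Printing Implicit Defensive.

Record sgraph := SGraph {
  vertex :> finType;
  adj : rel vertex;
  adj_sym : symmetric adj;
  adj_irrefl : irreflexive adj }.

Definition edges (G : sgraph) : {set {set G}} :=
  [set [set x; y] | x in [set: G], y in [set: G] & adj x y].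

Definition no_isolated (G : sgraph) : Prop :=
  forall x : G, exists y : G, adj x y.

Section Cycle.
Variable n : nat.

(* For n >= 3 the conjunct i != j is redundant; it only makes the graph
   loopless in the degenerate case n = 1. *)
Definition cycle_adj : rel 'I_n :=
  fun i j => (i != j) && ((j == ordS i) || (i == ordS j)).

Lemma cycle_adj_sym : symmetric cycle_adj.
Proof. by move=> i j; rewrite /cycle_adj eq_sym orbC. Qed.

Lemma cycle_adj_irrefl : irreflexive cycle_adj.
Proof. by move=> i; rewrite /cycle_adj eqxx. Qed.

Definition cycle_graph : sgraph := SGraph cycle_adj_sym cycle_adj_irrefl.
End Cycle.

(* A red/blue colouring of the edges of the complete graph on V; true is red
   and false is blue. Only the values at two-element sets are ever used. *)
Definition edge_coloring (V : finType) : finType := {ffun {set V} -> bool}.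

(* A copy is a not necessarily induced subgraph. *)
Definition mono_copy (V : finType) (c : edge_coloring V) (b : bool)
    (H : sgraph) : bool :=
  [exists f : {ffun H -> V}, injectiveb f &&
    [forall x, forall y, adj x y ==> (c [set f x; f y] == b)]].

Definition ramsey_prop (H G : sgraph) (N : nat) : bool :=
  (0 < N) && [forall c : edge_coloring 'I_N,
    mono_copy c true H || mono_copy c false G].

Lemma ramsey_clique (s t : nat) : exists N, forall (V : finType)
    (c : edge_coloring V) (A : {set V}), N <= #|A| ->
  exists (b : bool) (S : {set V}), [/\ S \subset A,
    #|S| = (if b then s else t) &
    {in S &, forall x y, x != y -> c [set x; y] = b}].
Proof.
elim: s t => [|s IHs] t.
  exists 0 => V c A _; exists true, set0.
  by split; [exact: sub0set | exact: cards0 | move=> x y; rewrite inE].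
elim: t => [|t [N2 IHt]].
  exists 0 => V c A _; exists false, set0.
  by split; [exact: sub0set | exact: cards0 | move=> x y; rewrite inE].
have [N1 {}IHs] := IHs t.+1.
exists (N1 + N2).+1 => V c A leNA.
have [x xA] : exists x, x \in A.
  by apply/card_gt0P; apply: leq_trans leNA.
pose B b := [set y in A :\ x | c [set x; y] == b].
have cardB : #|A| = (#|B true| + #|B false|).+1.
  rewrite (cardsD1 x A) xA add1n; congr _.+1.
  have -> : A :\ x = B true :|: B false.
    by apply/setP=> y; rewrite !inE; case: (c _);
      rewrite ?andbT ?andbF ?orbF.
  rewrite cardsU [B true :&: B false](_ : _ = set0) ?cards0 ?subn0 //.
  by apply/setP=> y; rewrite !inE; case: (c _); rewrite ?andbT ?andbF.
have BA b : B b \subset A by apply/subsetP => y; rewrite !inE => /andP[/andP[]].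
have ext (b : bool) (S : {set V}) (n : nat) : S \subset B b -> #|S| = n ->
    {in S &, forall y z, y != z -> c [set y; z] = b} ->
    [/\ x |: S \subset A, #|x |: S| = n.+1 &
      {in x |: S &, forall y z, y != z -> c [set y; z] = b}].
  move=> SB cS mS.
  have xS y : y \in S -> y != x /\ c [set x; y] = b.
    by move/(subsetP SB); rewrite !inE => /andP[/andP[-> _] /eqP].
  split.
  - by rewrite subUset sub1set xA (subset_trans SB).
  - rewrite cardsU1 cS; case: (boolP (x \in S)) => // /xS[].
    by rewrite eqxx.
  - move=> y z; rewrite !inE => /orP[/eqP->|yS] /orP[/eqP->|zS].
    + by rewrite eqxx.
    + by have [] := xS z zS.
    + by rewrite setUC; have [] := xS y yS.
    + exact: mS.
have : (N1 <= #|B true|) || (N2 <= #|B false|).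
  rewrite cardB ltnS in leNA; case: (leqP N1 #|B true|) => //= lt1.
  by rewrite -(leq_add2l N1) (leq_trans leNA) // leq_add2r ltnW.
case/orP => [/(IHs _ c)|/(IHt _ c)] [[] [S [SB cS mS]]].
- by exists true, (x |: S); apply: ext.
- by exists false, S; split=> //; apply: subset_trans SB _.
- by exists true, S; split=> //; apply: subset_trans SB _.
- by exists false, (x |: S); apply: ext.
Qed.

Lemma clique_mono_copy (V : finType) (c : edge_coloring V) (b : bool)
    (H : sgraph) (S : {set V}) : #|S| = #|H| ->
  {in S &, forall x y, x != y -> c [set x; y] = b} -> mono_copy c b H.
Proof.
move=> cS mS.
pose g (x : H) : V := enum_val (cast_ord (esym cS) (enum_rank x)).
have g_inj : injective g.
  by move=> x y /enum_val_inj /cast_ord_inj /enum_rank_inj.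
apply/existsP; exists (finfun g); apply/andP; split.
  by apply/injectiveP => x y; rewrite !ffunE => /g_inj.
apply/forallP => x; apply/forallP => y; apply/implyP => xy.
rewrite !ffunE; apply/eqP/mS; rewrite ?enum_valP //.
by rewrite (inj_eq g_inj); apply: contraL xy => /eqP->; rewrite adj_irrefl.
Qed.

Lemma ramsey_exists (H G : sgraph) : exists N, ramsey_prop H G N.
Proof.
have [N HN] := ramsey_clique #|H| #|G|.
exists N.+1; apply/forallP => c.
have [|b [S [_ cS mS]]] := HN _ c [set: 'I_N.+1].
  by rewrite cardsT card_ord.
by apply/orP; case: b cS mS => cS mS; [left|right]; apply: clique_mono_copy cS mS.
Qed.

Definition ramsey_number (H G : sgraph) : nat := ex_minn (ramsey_exists H G).

(* Main.v *)
Require Import Defs.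
From mathcomp Require Import all_boot zify.

(* Let the red graph on N vertices have no (2k+1)-cycle; the blue copy of G is
   built on growing vertex subsets S. If v has minimum degree d in G[S], then
   d #|S| <= 2m, so an embedding of G[S \ v] extends to v unless some red degree
   exceeds #|S| (1 + 1/q), with q about m^(1/20). A red neighbourhood X of that
   size has no red path on 2k vertices, hence is sparse: without its vertices of
   red degree > 16kq it still exceeds #|S| by a surplus of order #|S|/q. As G is
   sqrt(2m)-degenerate, G[S] embeds there greedily, provided that #|S| is at
   least of order q^2 sqrt(m) ~ m^(3/5). For smaller S there is a blue clique on
   #|S| vertices, since r(C_(2k+1), K_n) = O(n^(3/2)) and N > 2m; this bound
   holds because first and second neighbourhoods of a vertex are both
   2k-degenerate in red. *)

Set Implicit Arguments.
Unset Strict Implicit.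
Unset Printing Implicit Defensive.

(** * Degenerate graphs: independent sets, degree sums and paths *)

Definition deg_in (T : finType) (e : rel T) (Y : {set T}) (x : T) : nat :=
  #|[set y in Y | e x y]|.

(** The inequality is strict, so for d > 0 this is (d-1)-degeneracy in the usual sense. *)
Definition degenerate (T : finType) (e : rel T) (d : nat) (Z : {set T}) : Prop :=
  forall Y : {set T}, Y \subset Z -> Y != set0 ->
  exists2 y, y \in Y & deg_in e Y y < d.

Definition independent (T : finType) (e : rel T) (I : {set T}) : Prop :=
  {in I &, forall x y, ~~ e x y}.

Section Degeneracy.
Variables (T : finType) (e : rel T).
Hypotheses (e_sym : symmetric e) (e_irr : irreflexive e).

Lemma deg_in_subset (Y Z : {set T}) x :
  Y \subset Z -> deg_in e Y x <= deg_in e Z x.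
Proof.
move=> /subsetP sYZ; apply/subset_leq_card/subsetP => y.
by rewrite !inE => /andP[/sYZ-> ->].
Qed.

Lemma degenerateS d (Y Z : {set T}) :
  Y \subset Z -> degenerate e d Z -> degenerate e d Y.
Proof. by move=> sYZ dZ A sAY; apply/dZ/(subset_trans sAY). Qed.

Lemma min_degree_or_degenerate d (Z : {set T}) :
  (forall Y : {set T}, Y \subset Z -> Y != set0 ->
     (forall y, y \in Y -> d <= deg_in e Y y) -> False) -> degenerate e d Z.
Proof.
move=> H Y sYZ Y0.
case: (boolP [exists y in Y, deg_in e Y y < d]) => [/exists_inP //|].
rewrite negb_exists_in => /forall_inP hY; case: (H Y sYZ Y0) => y /hY.
by rewrite -leqNgt.
Qed.

(** Pick a vertex of degree below [d], delete it with its neighbours, at most [d] vertices in all,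
    and recurse on the rest. *)
Lemma degenerate_independent d (Z : {set T}) : degenerate e d Z ->
  exists I : {set T}, [/\ I \subset Z, independent e I & #|Z| <= d * #|I|].
Proof.
have [n] := ubnP #|Z|; elim: n Z => // n IHn Z; rewrite ltnS => leZn dZ.
have [->|Z0] := eqVneq Z set0.
  by exists set0; split; rewrite ?sub0set ?cards0 // => x y; rewrite inE.
have [y yZ dy] := dZ Z (subxx _) Z0.
pose A := [set z in Z | e y z]; pose Z' := Z :\: (y |: A).
have sZ'Z : Z' \subset Z by apply: subsetDl.
have sAZ : y |: A \subset Z.
  by apply/subsetP => z; rewrite !inE => /orP[/eqP->|/andP[]].
have cA : #|y |: A| <= d.
  by rewrite (leq_trans (leq_card_setU _ _)) // cards1.
have cZ : #|Z| = #|y |: A| + #|Z'|.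
  by rewrite -(cardsID (y |: A) Z) (setIidPr sAZ).
have cA0 : 0 < #|y |: A| by apply/card_gt0P; exists y; rewrite !inE eqxx.
have [|I [sI iI cI]] := IHn Z' _ (degenerateS sZ'Z dZ); first by lia.
have yI : y \notin I by apply/negP => /(subsetP sI); rewrite !inE eqxx.
have nI z : z \in I -> ~~ e y z.
  by move/(subsetP sI); rewrite !inE => /andP[/norP[_]]; case: (z \in Z).
exists (y |: I); split.
- by rewrite subUset sub1set yZ (subset_trans sI).
- move=> a b; rewrite !inE => /orP[/eqP->|aI] /orP[/eqP->|bI].
  + by rewrite e_irr.
  + exact: nI.
  + by rewrite e_sym nI.
  + exact: iI.
- by rewrite cardsU1 yI cZ mulnDr muln1 leq_add.
Qed.

(** Deleting a vertex of degree below [d] lowers the degree sum by twice that degree. *)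
Lemma degenerate_degree_sum d (Z : {set T}) : degenerate e d Z ->
  \sum_(z in Z) deg_in e Z z <= 2 * d * #|Z|.
Proof.
have [n] := ubnP #|Z|; elim: n Z => // n IHn Z; rewrite ltnS => leZn dZ.
have [->|Z0] := eqVneq Z set0; first by rewrite big_set0.
have [y yZ dy] := dZ Z (subxx _) Z0.
have cZ := cardsD1 y Z; rewrite yZ in cZ.
have {}IHn := IHn (Z :\ y) _ (degenerateS (subD1set Z y) dZ).
rewrite (big_setD1 y) //=.
have -> : \sum_(z in Z :\ y) deg_in e Z z =
    \sum_(z in Z :\ y) (deg_in e (Z :\ y) z + e z y).
  apply: eq_bigr => z zZ; rewrite /deg_in (cardsD1 y) !inE yZ /= addnC.
  congr (_ + _); apply: eq_card => w; rewrite !inE.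
  by case: (w == y).
rewrite big_split /=.
have -> : \sum_(z in Z :\ y) (e z y : nat) = deg_in e Z y.
  rewrite /deg_in -sum1_card big_mkcond [RHS]big_mkcond /=.
  apply: eq_bigr => z _; rewrite !inE e_sym; have [->|_] := eqVneq z y.
    by rewrite e_irr andbF.
  by case: (z \in Z); case: (e y z).
have := IHn _; move/(_ ltac:(lia)); nia.
Qed.

(** Markov's inequality for the degree sum. *)
Lemma card_high_degree d D (Z : {set T}) : degenerate e d Z ->
  #|[set z in Z | D < deg_in e Z z]| * D <= 2 * d * #|Z|.
Proof.
move/degenerate_degree_sum; apply: leq_trans.
rewrite -sum_nat_const [X in _ <= X](bigID (fun z => D < deg_in e Z z)) /=.
apply: leq_trans (leq_addr _ _).
under eq_bigl do rewrite inE.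
by apply: leq_sum => z /andP[_ /ltnW].
Qed.

(** Greedy walk: the current vertex has more neighbours in [H] than [A] has elements, so the next
    one can avoid [A]. Each vertex left behind joins [A], which keeps the path simple. *)
Lemma min_degree_path d (H A : {set T}) l x :
  (forall y, y \in H -> d <= deg_in e H y) -> x \in H -> #|A| + l <= d ->
  exists p : seq T, [/\ size p = l, uniq (x :: p), path e x p,
    {subset p <= H} & {in p, forall y, y \notin A}].
Proof.
move=> dH; elim: l A x => [|l IHl] A x xH cA; first by exists [::].
have [y] : exists y, y \in [set y in H | e x y] :\: A.
  apply/card_gt0P; rewrite cardsD subn_gt0.
  apply: leq_ltn_trans (subset_leq_card (subsetIr _ _)) _.
  by apply: leq_trans (dH x xH); lia.
rewrite !inE => /andP[yA /andP[yH exy]].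
have cA' : #|x |: A| + l <= d by rewrite cardsU1; lia.
have [p [sp up pp Hp Ap]] := IHl (x |: A) y yH cA'.
exists (y :: p); split.
- by rewrite /= sp.
- rewrite cons_uniq up inE negb_or andbT; apply/andP; split.
    by apply: contraTneq exy => ->; rewrite e_irr.
  by apply/negP => /Ap; rewrite !inE eqxx.
- by rewrite /= exy.
- by move=> z; rewrite inE => /orP[/eqP->|/Hp].
- move=> z; rewrite inE => /orP[/eqP-> //|/Ap].
  by rewrite !inE => /norP[].
Qed.

End Degeneracy.

(** * Graphs without a (2k+1)-cycle: neighbourhoods and independent sets *)

Section OddCycleFree.
Variables (V : finType) (e : rel V) (k : nat).
Hypotheses (e_sym : symmetric e) (e_irr : irreflexive e) (k_ge2 : 2 <= k).
Hypothesis no_cycle : forall x p, size p = 2 * k -> uniq (x :: p) ->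
  path e x p -> e (last x p) x -> False.

(** A path on 2k vertices of [H] starting at [x] closes through [u] to a (2k+1)-cycle. The last
    hypothesis speaks of walks from [x] to fit both uses: [u] is the centre of a neighbourhood, or
    the parent shared by all vertices reached from [x]. *)
Lemma min_degree_common_neighbour (u : V) (H : {set V}) x : x \in H ->
  (forall y, y \in H -> 2 * k <= deg_in e H y) -> u \notin H -> e u x ->
  (forall p : seq V, {subset p <= H} -> path e x p -> e u (last x p)) -> False.
Proof.
move=> xH dH uH eux eu.
have [|p [sp up pp Hp _]] :=
  min_degree_path (A := set0) (l := 2 * k - 1) e_irr dH xH.
  by rewrite cards0; lia.
apply: (@no_cycle u (x :: p)) => /=.
- by rewrite sp; lia.
- rewrite -cons_uniq (cons_uniq u) up andbT inE negb_or.
  apply/andP; split; first by apply: contraNneq uH => ->.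
  by apply: contra uH => /Hp.
- by rewrite eux.
- by rewrite e_sym eu.
Qed.

Lemma neighbourhood_degenerate (v : V) (Z : {set V}) :
  {in Z, forall z, e v z} -> degenerate e (2 * k) Z.
Proof.
move=> vZ; apply: min_degree_or_degenerate => Y sYZ /set0Pn[x xY] dY.
have vY y : y \in Y -> e v y by move/(subsetP sYZ)/vZ.
apply: (@min_degree_common_neighbour v Y x) => //; last 2 first.
- exact: vY.
- by move=> p sp _; apply/vY; have := mem_last x p; rewrite inE => /orP[/eqP->|/sp].
by apply/negP => /vY; rewrite e_irr.
Qed.

(* In a subset of large minimum degree, a path on 2k - 2 vertices whose
   endpoints had distinct parents would close to a (2k+1)-cycle through v.
   This forces all neighbours of a vertex to share their parent, and then, as
   2k - 3 is odd, adjacent vertices to share their parent as well. *)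
Lemma second_neighbourhood_degenerate (v : V) (Z : {set V}) (par : V -> V) :
  {in Z, forall z, [/\ z != v, ~~ e v z, e v (par z) & e (par z) z]} ->
  degenerate e (2 * k) Z.
Proof.
move=> vZ; apply: min_degree_or_degenerate => Y sYZ /set0Pn[x xY] dY.
have vY y : y \in Y -> [/\ y != v, ~~ e v y, e v (par y) & e (par y) y].
  by move/(subsetP sYZ)/vZ.
have parY y z : y \in Y -> z \in Y -> par z != y.
  by move=> yY zY; apply: contraTneq (yY) => <-; apply/negP => /vY[_ /negP + _ _];
     have [_ _ ->] := vY z zY.
have lastY y p : y \in Y -> {subset p <= Y} -> last y p \in Y.
  by move=> yY sp; have := mem_last y p; rewrite inE => /orP[/eqP->|/sp].
have ends y p : y \in Y -> {subset p <= Y} -> uniq (y :: p) -> path e y p ->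
    size p = 2 * k - 3 -> par y = par (last y p).
  move=> yY sp up pp szp; apply/eqP; apply: contraT => npar.
  have lY := lastY y p yY sp.
  have [_ _ evy eyy] := vY y yY.
  have [_ _ evl ell] := vY _ lY.
  have inY z : z \in y :: p -> z \in Y by rewrite inE => /orP[/eqP->|/sp].
  case: (@no_cycle v (par y :: y :: rcons p (par (last y p)))).
  - by rewrite /= size_rcons szp; clear -k_ge2; lia.
  - have vpar z : z \in Y -> v != par z.
      by move=> /vY[_ _ + _]; apply: contraTneq => <-; rewrite e_irr.
    have vn : v \notin y :: p by apply/negP => /inY /vY[]; rewrite eqxx.
    have pn z : z \in Y -> par z \notin y :: p.
      by move=> zY; apply/negP => /inY /parY /(_ zY); rewrite eqxx.
    have uq (q : seq V) a b c : uniq q -> a \notin q -> b \notin q -> c \notin q ->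
        a != b -> a != c -> b != c -> uniq [:: a, b & rcons q c].
      move=> Uq aq bq cq ab ac bc; rewrite 2!cons_uniq rcons_uniq Uq cq.
      by rewrite in_cons !mem_rcons !in_cons !negb_or ab ac bc aq bq.
    by apply: (uq (y :: p)) => //; [apply: pn | apply: pn | apply: vpar | apply: vpar].
  - by rewrite /= evy eyy rcons_path pp e_sym.
  - by rewrite /= last_rcons e_sym.
have siblings w a b : w \in Y -> a \in Y -> b \in Y -> e w a -> e w b ->
    par a = par b.
  move=> wY aY bY ewa ewb.
  (* One path from [w] avoiding both [a] and [b] serves twice: prefixed by either of them it has 2k
     - 2 vertices, and its end is the same. *)
  have [|p [sp up pp Hp Ap]] :=
    min_degree_path (A := [set a; b]) (l := 2 * k - 4) e_irr dY wY.
    by rewrite cards2; clear -k_ge2; lia.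
  have H c : c \in Y -> c \in [set a; b] -> e w c -> par c = par (last w p).
    move=> cY cab ewc; apply: (ends c (w :: p)) => //.
    - by move=> z; rewrite inE => /orP[/eqP->|/Hp].
    - rewrite cons_uniq up inE negb_or andbT; apply/andP; split.
        by apply: contraTneq ewc => ->; rewrite e_irr.
      by apply/negP => /Ap; rewrite cab.
    - by rewrite /= e_sym ewc.
    - by rewrite /= sp; clear -k_ge2; lia.
  by rewrite (H a) ?(H b) // !inE eqxx ?orbT.
(* Two steps of a walk join two neighbours of the middle vertex, so [siblings] preserves the
   parent. *)
have even_path n y p : y \in Y -> {subset p <= Y} -> path e y p ->
    size p = n.*2 -> par y = par (last y p).
  elim: n y p => [|n IHn] y [|a [|b p]] //= yY sp /and3P[eya eab pp] [szp].
  have aY : a \in Y by apply: sp; rewrite !inE eqxx.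
  have bY : b \in Y by apply: sp; rewrite !inE eqxx orbT.
  rewrite (siblings a y b) //; last by rewrite e_sym.
  by apply: IHn => // z zp; apply: sp; rewrite !inE zp !orbT.
have par_adj y z : y \in Y -> z \in Y -> e y z -> par y = par z.
  move=> yY zY eyz.
  have [|p [sp up pp Hp Ap]] :=
    min_degree_path (A := [set y]) (l := 2 * k - 4) e_irr dY zY.
    by rewrite cards1; lia.
  rewrite (even_path (k - 2) z p) //; last by rewrite sp; lia.
  apply: (ends y (z :: p)) => //.
  - by move=> w; rewrite inE => /orP[/eqP->|/Hp].
  - rewrite cons_uniq up inE negb_or andbT; apply/andP; split.
      by apply: contraTneq eyz => ->; rewrite e_irr.
    by apply/negP => /Ap; rewrite inE eqxx.
  - by rewrite /= eyz.
  - by rewrite /= sp; clear -k_ge2; lia.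
have [_ _ _ exx] := vY x xY.
(* The parent is constant along every walk in [Y], so [par x] is adjacent to all vertices reached
   from [x]. *)
apply: (@min_degree_common_neighbour (par x) Y x) => //.
  by apply/negP => H; have := parY _ _ H xY; rewrite eqxx.
have par_path p y : y \in Y -> {subset p <= Y} -> path e y p ->
    par y = par (last y p).
  elim: p y => //= a p IHp y yY sp /andP[eya pp].
  have aY : a \in Y by apply: sp; rewrite inE eqxx.
  rewrite (par_adj y a) //; apply: IHp => // z zp.
  by apply: sp; rewrite inE zp orbT.
move=> p sp pp; rewrite (par_path p x) //.
by have [] := vY _ (lastY x p xY sp).
Qed.

(* Either a vertex has at most s neighbours, and it can be picked at the cost
   of s + 1 vertices, or an independent set I1 with 2k #|I1| >= #|G1| can be
   picked inside its neighbourhood G1; the latter costs 1 + #|G1| + #|G2|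
   where the second neighbourhood G2 has size O(P) = O(s #|G1|). *)
Lemma large_independent_set (P s : nat) : 0 < s -> P <= s ^ 2 ->
  (forall I : {set V}, independent e I -> #|I| <= P) ->
  forall W : {set V}, exists I : {set V},
    [/\ I \subset W, independent e I & #|W| <= 8 * k ^ 2 * s * #|I|].
Proof.
move=> s0 Ps maxI W; set L := 8 * k ^ 2 * s.
have [n] := ubnP #|W|; elim: n W => // n IHn W; rewrite ltnS => leWn.
have [->|/set0Pn[v vW]] := eqVneq W set0.
  by exists set0; split; rewrite ?sub0set ?cards0 // => x y; rewrite inE.
(* [J] is picked and [A] discarded. As [A] contains all neighbours of [J] in [W], [J] can be joined
   to the independent set that induction finds in the rest. *)
have step (J A : {set V}) : J \subset A -> A \subset W -> A != set0 ->
    independent e J -> {in J & W, forall x y, e x y -> y \in A} ->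
    #|A| <= L * #|J| -> exists I : {set V},
    [/\ I \subset W, independent e I & #|W| <= L * #|I|].
  move=> sJA sAW A0 iJ nJ cA.
  have cW : #|W| = #|A| + #|W :\: A| by rewrite -(cardsID A W) (setIidPr sAW).
  have cA0 : 0 < #|A| by rewrite card_gt0.
  have [|I [sI iI cI]] := IHn (W :\: A); first by lia.
  have JI x y : x \in J -> y \in I -> ~~ e x y.
    move=> xJ /(subsetP sI); rewrite inE => /andP[yA yW].
    by apply: contra yA; apply: nJ.
  exists (J :|: I); split.
  - by rewrite subUset (subset_trans sJA) // (subset_trans sI) // subsetDl.
  - move=> x y; rewrite !inE => /orP[xJ|xI] /orP[yJ|yI].
    + exact: iJ.
    + exact: JI.
    + by rewrite e_sym JI.
    + exact: iI.
  - rewrite cardsU [J :&: I](_ : _ = set0) ?cards0 ?subn0.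
      by rewrite cW mulnDr leq_add.
    apply/setP => x; rewrite !inE; apply/negP => /andP[/(subsetP sJA) xA].
    by move/(subsetP sI); rewrite inE xA.
pose G1 := [set y in W | e v y].
pose G2 := [set z in W | [&& z != v, ~~ e v z & [exists y in G1, e y z]]].
have sG1 : G1 \subset W by apply/subsetP => y; rewrite !inE => /andP[].
have sG2 : G2 \subset W by apply/subsetP => y; rewrite !inE => /andP[].
have [le1|gt1] := leqP #|G1| s.
  apply: (step [set v] (v |: G1)).
  - by rewrite sub1set !inE eqxx.
  - by rewrite subUset sub1set vW.
  - by apply/set0Pn; exists v; rewrite !inE eqxx.
  - by move=> x y; rewrite !inE => /eqP-> /eqP->; rewrite e_irr.
  - by move=> x y; rewrite !inE => /eqP-> -> ->; rewrite orbT.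
  - rewrite cards1 muln1 (leq_trans (leq_card_setU _ _)) // cards1 /L; nia.
have [|I1 [sI1 iI1 cI1]] :=
  degenerate_independent e_sym e_irr (@neighbourhood_degenerate v G1 _).
  by move=> z; rewrite inE => /andP[].
(* The default [v] is never taken on [G2], where every vertex has a neighbour in [G1]. *)
pose par z := odflt v [pick y in G1 | e y z].
have [|I2 [sI2 iI2 cI2]] :=
  degenerate_independent e_sym e_irr (@second_neighbourhood_degenerate v G2 par _).
  move=> z; rewrite inE => /and4P[_ zv evz /exists_inP[y yG1 eyz]].
  rewrite /par; case: pickP => [w /andP[]|/(_ y)]; last by rewrite /= yG1 eyz.
  by rewrite inE => /andP[_ evw] ewz.
apply: (step I1 (v |: (G1 :|: G2))).
- by apply: subset_trans sI1 _; apply/subsetP => y yG; rewrite !in_setU yG orbT.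
- by rewrite !subUset sub1set vW sG1.
- by apply/set0Pn; exists v; rewrite !inE eqxx.
- exact: iI1.
- move=> x y /(subsetP sI1) xG1 yW exy; rewrite !inE yW /=.
  case: (eqVneq y v) => //= _; case: (e v y) => //=.
  by apply/exists_inP; exists x.
- have := maxI I2 iI2.
  have := leq_card_setU [set v] (G1 :|: G2).
  have := leq_card_setU G1 G2; rewrite cards1 /L => c1 c2 c3.
  have {}c3 : #|G2| <= 2 * k * s * #|G1|.
    rewrite -mulnA (leq_trans cI2) // leq_mul //.
    rewrite (leq_trans c3) // (leq_trans Ps) // -mulnn leq_mul //; exact: ltnW.
  (* Here [v] is charged to [G1], which has more than [s] vertices. With #|G1| <= 2k #|I1| the cost
     per vertex of [I1] is 2k(2 + 2ks) <= 8 k^2 s. *)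
  have {c1 c2 c3} : #|v |: (G1 :|: G2)| <= (2 + 2 * k * s) * #|G1|.
    apply: leq_trans c2 _; rewrite mulnDl mul2n -addnn -addnA.
    rewrite leq_add ?(leq_ltn_trans _ gt1) //.
    by rewrite (leq_trans c1) // leq_add2l.
  move/leq_trans; apply.
  apply: leq_trans (leq_mul (leqnn _) cI1) _.
  rewrite mulnA leq_mul2r; apply/orP; right; clear -s0 k_ge2; nia.
Qed.

End OddCycleFree.

(** * Greedy blue embeddings and degeneracy of G *)

Section Embedding.
Variables (V : finType) (e : rel V) (G : sgraph).
Hypothesis e_sym : symmetric e.

Definition blue_embedding (S : {set G}) (X : {set V}) (f : G -> V) : Prop :=
  [/\ {in S &, injective f}, {in S, forall x, f x \in X} &
      {in S &, forall x y, adj x y -> ~~ e (f x) (f y)}].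

(** The image of [v] must avoid the #|S| - 1 vertices in use and, for each neighbour of [v] in [S],
    the at most [D] red neighbours of its image. The last hypothesis leaves a vertex of [X] free. *)
Lemma extend_blue_embedding (S : {set G}) (X : {set V}) f v D :
  v \in S -> blue_embedding (S :\ v) X f ->
  (forall x, x \in X -> deg_in e X x <= D) ->
  #|S|.-1 + deg_in (@adj G) S v * D < #|X| ->
  exists g, blue_embedding S X g.
Proof.
move=> vS [f_inj fX f_blue] degX cX.
pose Nv := [set y in S | adj v y].
have vNv y : y \in Nv -> y \in S :\ v.
  rewrite !inE => /andP[-> vy]; rewrite andbT.
  by apply: contraTneq vy => ->; rewrite adj_irrefl.
pose bad := f @: (S :\ v) :|: \bigcup_(y in Nv) [set x in X | e (f y) x].
have cbad : #|bad| < #|X|.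
  apply: leq_ltn_trans cX; apply: leq_trans (leq_card_setU _ _) _.
  apply: leq_add.
    by apply: leq_trans (leq_imset_card _ _) _; rewrite (cardsD1 v S) vS.
  rewrite /deg_in -/Nv -sum_nat_const.
  elim/big_ind2: _ => [|B1 n1 B2 n2 h1 h2|y /vNv yS]; first by rewrite cards0.
    by apply: leq_trans (leq_card_setU _ _) (leq_add h1 h2).
  exact/degX/fX.
have [z] : exists z, z \in X :\: bad.
  apply/card_gt0P; rewrite cardsD subn_gt0.
  exact: leq_ltn_trans (subset_leq_card (subsetIr _ _)) cbad.
rewrite !inE => /andP[/norP[zf /bigcupP zN] zX].
have zblue y : y \in S -> adj v y -> ~~ e (f y) z.
  move=> yS vy; apply/negP => eyz; apply: zN; exists y; first by rewrite inE yS.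
  by rewrite inE zX.
have fz y : y \in S :\ v -> f y != z.
  by move=> yS; apply: contraNneq zf => <-; apply: imset_f.
exists (fun x => if x == v then z else f x); split.
- move=> x y xS yS; case: eqVneq => [->|xv]; case: eqVneq => [->|yv] // fxy.
  + by have := fz y; rewrite !inE yv yS -fxy eqxx => /(_ isT).
  + by have := fz x; rewrite !inE xv xS fxy eqxx => /(_ isT).
  + by apply: f_inj => //; rewrite !inE ?xv ?yv.
- by move=> x xS; case: eqVneq => // xv; apply: fX; rewrite !inE xv.
- move=> x y xS yS; case: eqVneq => [->|xv]; case: eqVneq => [->|yv] xy.
  + by rewrite adj_irrefl in xy.
  + by rewrite e_sym zblue.
  + by apply: zblue => //; rewrite adj_sym.
  + by apply: f_blue => //; rewrite !inE ?xv ?yv.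
Qed.

Lemma greedy_blue_embedding (S : {set G}) (X : {set V}) b D :
  0 < #|V| -> degenerate (@adj G) b.+1 S ->
  (forall x, x \in X -> deg_in e X x <= D) ->
  #|S| + b * D <= #|X| -> exists f, blue_embedding S X f.
Proof.
move=> /card_gt0P[x0 _] + degX.
have [n] := ubnP #|S|; elim: n S => // n IHn S; rewrite ltnS => leSn dS cX.
have [->|S0] := eqVneq S set0.
  by exists (fun=> x0); split=> x; rewrite ?inE // => y; rewrite inE.
have [v vS] := dS S (subxx _) S0; rewrite ltnS => dv.
have cS := cardsD1 v S; rewrite vS in cS.
have [||| f fP] := IHn (S :\ v); first by lia.
- exact: degenerateS (subD1set S v) dS.
- by lia.
apply: extend_blue_embedding vS fP degX _.
have : deg_in (@adj G) S v * D <= b * D by rewrite leq_mul2r dv orbT.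
by lia.
Qed.

(** Handshake count: at most two ordered pairs lie over each edge. *)
Lemma sum_degree_le : \sum_(x : G) deg_in (@adj G) setT x <= 2 * #|edges G|.
Proof.
pose P := [set u : G * G | adj u.1 u.2].
have -> : \sum_(x : G) deg_in (@adj G) setT x = #|P|.
  rewrite -sum1_card.
  under [RHS]eq_bigl do rewrite inE.
  rewrite -(pair_big_dep xpredT (fun x y => adj x y) (fun _ _ => 1)) /=.
  by apply: eq_bigr => x _; rewrite sum1_card; apply: eq_card => y; rewrite !inE.
rewrite -sum1_card (partition_big (fun u => [set u.1; u.2]) (mem (edges G))) /=.
  rewrite mulnC -sum_nat_const; apply: leq_sum => E /imset2P[a b _ _ ->].
  rewrite sum1_card.
  apply: leq_trans (subset_leq_card (B := [set (a, b); (b, a)]) _) _; last first.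
    by rewrite cards2; case: eqP.
  apply/subsetP => -[x y] /andP[]; rewrite /= inE /= => xy /eqP E2.
  have xE : x \in [set a; b] by rewrite -E2 !inE eqxx.
  have yE : y \in [set a; b] by rewrite -E2 !inE eqxx orbT.
  have aE : a \in [set x; y] by rewrite E2 !inE eqxx.
  have bE : b \in [set x; y] by rewrite E2 !inE eqxx orbT.
  have nxy : x != y by apply: contraTneq xy => ->; rewrite adj_irrefl.
  move: xE yE aE bE nxy; rewrite !inE -!pair_eqE /=.
  by do 2![case/orP => /eqP->]; rewrite ?eqxx ?orbT.
by move=> [x y]; rewrite inE /= => xy; apply/imset2P; exists x y; rewrite ?inE.
Qed.

Lemma min_degree_vertex (S : {set G}) : S != set0 ->
  exists2 v, v \in S & deg_in (@adj G) S v * #|S| <= 2 * #|edges G|.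
Proof.
case/set0Pn=> x xS.
have [v vS vmin] := arg_minnP (deg_in (@adj G) S) xS.
exists v => //; apply: leq_trans sum_degree_le.
apply: leq_trans (_ : \sum_(y in S) deg_in (@adj G) setT y <= _); last first.
  by rewrite [X in _ <= X](bigID (mem S)) leq_addr.
rewrite mulnC -sum_nat_const; apply: leq_sum => y yS.
by apply: leq_trans (vmin y yS) (deg_in_subset _ _ (subsetT _)).
Qed.

(** The minimum degree of G[Y] is at most #|Y| and, times #|Y|, at most 2m; hence its square is at
    most 2m. *)
Lemma sqrt_degenerate b (S : {set G}) : 2 * #|edges G| <= b ^ 2 ->
  degenerate (@adj G) b.+1 S.
Proof.
move=> hb Y _ Y0; have [v vY hv] := min_degree_vertex Y0; exists v => //.
have : deg_in (@adj G) Y v <= #|Y|.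
  by apply/subset_leq_card/subsetP => y; rewrite inE => /andP[].
by rewrite ltnS; nia.
Qed.

End Embedding.

(** * Blue copies of G when red has no (2k+1)-cycle *)

Section OddCycleVersusGraph.
Variables (V : finType) (e : rel V) (k : nat).
Hypotheses (e_sym : symmetric e) (e_irr : irreflexive e) (k_ge2 : 2 <= k).
Hypothesis no_cycle : forall x p, size p = 2 * k -> uniq (x :: p) ->
  path e x p -> e (last x p) x -> False.
Variables (G : sgraph) (q b s : nat).
Hypotheses (q_gt0 : 0 < q) (s_gt0 : 0 < s).
(* b bounds the degeneracy of G, and 32 k q^2 b is the size of S from which on
   the surplus in a red neighbourhood pays for the greedy embedding. *)
Hypothesis b_large : 2 * #|edges G| <= b ^ 2.
Hypothesis s_large : 32 * k * q ^ 2 * b <= s ^ 2.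

(** The degree sum inside [X] is at most 4k #|X|, so at most #|X|/(4q) vertices have degree above
    16kq. What is left has at least (1 - 1/(4q))(1 + 1/q) #|S| >= (1 + 1/(2q)) #|S| vertices, and
    the surplus #|S|/(2q) is at least 16kqb. *)
Lemma blue_embedding_in_neighbourhood (u : V) (S : {set G}) :
  32 * k * q ^ 2 * b <= #|S| ->
  q.+1 * #|S| <= q * deg_in e setT u ->
  exists f, blue_embedding e S setT f.
Proof.
move=> hS hu; pose X := [set y in setT | e u y].
have dX : degenerate e (2 * k) X.
  by apply: (neighbourhood_degenerate e_sym e_irr k_ge2 no_cycle (v := u)) => z;
     rewrite !inE.
have := card_high_degree e_sym e_irr (16 * k * q) dX.
set H := [set z in X | _] => cH.
have sHX : H \subset X by apply/subsetP => y; rewrite inE => /andP[].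
have cX : #|X| = #|H| + #|X :\: H| by rewrite -(cardsID H X) (setIidPr sHX).
have {}cH : 4 * q * #|H| <= #|X|.
  by rewrite -(@leq_pmul2l (4 * k)) ?muln_gt0 /= ?(ltnW k_ge2) //; lia.
have cX' : #|S| + b * (16 * k * q) <= #|X :\: H|.
  have {}hu : q.+1 * #|S| <= q * #|X| by [].
  have h1 : (4 * q - 1) * #|X| <= 4 * q * #|X :\: H| by nia.
  have h2 : (4 * q - 1) * (q.+1 * #|S|) <= q * (4 * q * #|X :\: H|).
    apply: leq_trans (leq_mul (leqnn _) hu) _.
    by rewrite mulnCA leq_mul2l h1 orbT.
  rewrite -(@leq_pmul2l (4 * q ^ 2)) ?muln_gt0 ?expn_gt0 ?q_gt0 //.
  apply: leq_trans (_ : (4 * q - 1) * (q.+1 * #|S|) <= _); last by lia.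
  have h3 : 2 * q * (32 * k * q ^ 2 * b) <= 2 * q * #|S| by rewrite leq_mul2l hS orbT.
  have h4 : 4 * q ^ 2 * #|S| + 2 * q * #|S| <= (4 * q - 1) * (q.+1 * #|S|).
    by rewrite -mulnDl mulnA leq_mul2r; apply/orP; right; nia.
  by lia.
have [||||f [fi _ fb]] := @greedy_blue_embedding V e G e_sym S (X :\: H) b (16 * k * q).
- by apply/card_gt0P; exists u.
- exact: sqrt_degenerate.
- move=> x; rewrite inE => /andP[+ xX]; rewrite inE xX -leqNgt.
  by apply: leq_trans; apply/deg_in_subset/subsetDl.
- exact: cX'.
by exists f; split=> // x _; rewrite inE.
Qed.

(** A red-independent set is a blue clique: the greedy embedding with [D] = 0. *)
Lemma blue_embedding_of_clique (S : {set G}) (I : {set V}) :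
  0 < #|V| -> independent e I -> #|S| <= #|I| ->
  exists f, blue_embedding e S setT f.
Proof.
move=> V0 iI SI.
have [|||f [fi _ fb]] := @greedy_blue_embedding V e G e_sym S I b 0 V0.
- exact: sqrt_degenerate.
- move=> x xI; rewrite leqn0 cards_eq0; apply/eqP/setP => y; rewrite !inE.
  by apply/negP => /andP[yI]; apply/negP/iI.
- by rewrite muln0 addn0.
by exists f; split=> // x _; rewrite inE.
Qed.

(** The first bound on #|V| yields the blue clique for small [S]. The second pays for the extension
    step, which excludes at most #|S| - 1 + 2m(1 + 1/q) vertices. *)
Lemma blue_embedding_exists (S : {set G}) :
  8 * k ^ 2 * s * (32 * k * q ^ 2 * b) < #|V| ->
  q.+1 * (2 * #|edges G|) + q * #|G| <= q * #|V| ->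
  exists f, blue_embedding e S setT f.
Proof.
move=> cV1 cV2; have V0 : 0 < #|V| by apply: leq_ltn_trans cV1.
have [n] := ubnP #|S|; elim: n S => // n IHn S; rewrite ltnS => leSn.
have [ltS|leS] := ltnP #|S| (32 * k * q ^ 2 * b).
  case: (boolP [exists I : {set V},
    [forall x in I, forall y in I, ~~ e x y] && (#|S| <= #|I|)]) => [|noI].
    move=> /existsP[I /andP[/forall_inP iI SI]].
    apply: (blue_embedding_of_clique (I := I)) => // x y xI yI.
    by have /forall_inP := iI x xI; apply.
  have maxI (I : {set V}) : independent e I -> #|I| <= 32 * k * q ^ 2 * b.
    move=> iI; apply: leq_trans (ltnW ltS); rewrite leqNgt; apply/negP => SI.
    move/existsP: noI; apply; exists I; rewrite (ltnW SI) andbT.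
    by apply/forall_inP => x xI; apply/forall_inP => y yI; apply: iI.
  have [I [_ iI cI]] := large_independent_set e_sym e_irr k_ge2 no_cycle s_gt0
    s_large maxI setT.
  have := leq_mul (leqnn (8 * k ^ 2 * s)) (maxI I iI).
  by move/(leq_trans cI); rewrite cardsT leqNgt cV1.
have [S0|S0] := eqVneq S set0.
  by apply: (blue_embedding_of_clique (I := set0)); rewrite ?S0 ?cards0 // => x y;
     rewrite inE.
case: (boolP [exists u, q.+1 * #|S| <= q * deg_in e setT u]) => [/existsP[u]|].
  exact: blue_embedding_in_neighbourhood.
rewrite negb_exists => /forallP small.
have [v vS dv] := min_degree_vertex S0.
have cS := cardsD1 v S; rewrite vS in cS.
have [|f fP] := IHn (S :\ v); first by lia.
apply: (extend_blue_embedding e_sym (D := (q.+1 * #|S|) %/ q) vS fP).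
  move=> x _; rewrite leq_divRL // mulnC ltnW //.
  by have := small x; rewrite -ltnNge.
rewrite cardsT -(ltn_pmul2l q_gt0) mulnDr.
apply: leq_trans cV2.
have h1 : q * (deg_in (@adj G) S v * (q.+1 * #|S| %/ q)) <=
    q.+1 * (2 * #|edges G|).
  rewrite mulnCA [q * _]mulnC.
  apply: leq_trans (leq_mul (leqnn _) (leq_divM _ _)) _.
  by rewrite mulnCA leq_mul2l dv orbT.
have h2 : q * #|S|.-1 < q * #|G|.
  rewrite ltn_pmul2l // cS /=.
  by apply: leq_trans (max_card (mem S)); rewrite cS.
by lia.
Qed.

End OddCycleVersusGraph.

(** * From colourings to red graphs *)

Section Coloring.
Variables (V : finType) (c : edge_coloring V).

Definition red : rel V := fun x y => (x != y) && c [set x; y].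

Lemma red_sym : symmetric red.
Proof. by move=> x y; rewrite /red eq_sym setUC. Qed.

Lemma red_irrefl : irreflexive red.
Proof. by move=> x; rewrite /red eqxx. Qed.

Lemma red_cycle_copy n x p : size p = n -> uniq (x :: p) -> path red x p ->
  red (last x p) x -> mono_copy c true (cycle_graph n.+1).
Proof.
move=> szp up pp lp; pose f (i : 'I_n.+1) := nth x (x :: p) i.
apply/existsP; exists (finfun f); apply/andP; split.
  apply/injectiveP => i j; rewrite !ffunE => /eqP.
  by rewrite nth_uniq //= ?szp // => /eqP/val_inj.
have next (i : 'I_n.+1) : red (f i) (f (ordS i)).
  rewrite /f /=; have [lin|nin] := ltnP i n.
    rewrite modn_small ?ltnS //=.
    by have /pathP := pp => /(_ x i); apply; rewrite szp.
  (* The last index wraps around to 0: this is the closing edge. *)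
  have -> : i = n :> nat by apply/eqP; rewrite eqn_leq nin -ltnS ltn_ord.
  by rewrite modnn /= -szp nth_last.
apply/forallP => i; apply/forallP => j; apply/implyP => /andP[_].
rewrite !ffunE; case/orP => /eqP->; apply/eqP.
  by have /andP[] := next i.
by rewrite setUC; have /andP[] := next j.
Qed.

Lemma blue_copy (G : sgraph) f : blue_embedding red (G := G) setT setT f ->
  mono_copy c false G.
Proof.
move=> [fi _ fb]; apply/existsP; exists (finfun f); apply/andP; split.
  by apply/injectiveP => x y; rewrite !ffunE; apply: fi; rewrite inE.
apply/forallP => x; apply/forallP => y; apply/implyP => xy; rewrite !ffunE.
have := fb x y (in_setT _) (in_setT _) xy.
have -> : red (f x) (f y) = c [set f x; f y].
  rewrite /red; case: eqP => // /fi; rewrite !inE => /(_ isT isT) exy.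
  by rewrite exy adj_irrefl in xy.
by case: (c _).
Qed.

End Coloring.

Lemma ramsey_number_cycle_le k (G : sgraph) (q b s N : nat) :
  2 <= k -> 0 < q -> 0 < s -> 2 * #|edges G| <= b ^ 2 ->
  32 * k * q ^ 2 * b <= s ^ 2 ->
  8 * k ^ 2 * s * (32 * k * q ^ 2 * b) < N ->
  q.+1 * (2 * #|edges G|) + q * #|G| <= q * N ->
  ramsey_number (cycle_graph (2 * k + 1)) G <= N.
Proof.
move=> k2 q0 s0 hb hs hN1 hN2; rewrite /ramsey_number.
case: ex_minnP => r _; apply; rewrite /ramsey_prop (leq_ltn_trans _ hN1) //=.
apply/forallP => c.
case: (boolP (mono_copy c true _)) => //= nored.
have [x p szp up pp lp|||f fP] := @blue_embedding_exists 'I_N (red c) k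
  (@red_sym _ c) (@red_irrefl _ c) k2 _ G q b s q0 s0 hb hs setT.
- by move/negP: nored; apply; rewrite addn1; apply: red_cycle_copy lp.
- by rewrite card_ord.
- by rewrite card_ord.
exact: blue_copy fP.
Qed.

(* Choice of parameters and the real bound *)
From mathcomp Require Import all_order all_algebra.
From mathcomp Require Import all_classical all_reals all_analysis.
From mathcomp Require Import ring lra.
Import Order.TTheory GRing.Theory Num.Theory.

Local Open Scope ring_scope.

Theorem theorem2 (R : realType) (k : nat) (hk : (2 <= k)%N) :
  exists B : R, forall G : sgraph, (0 < #|G|)%N -> no_isolated G ->
    (ramsey_number (cycle_graph (2 * k + 1)) G)%:R
      <= 2 * (#|edges G|)%:R * (1 + B * (#|edges G|)%:R `^ (- (1 / 20)))
         + (#|G|)%:R :> R.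
Proof.
(* Numerical constants are absorbed using k >= 2: 8 <= k^3 and 96 <= k^7. The exponent is 18 = 3 + 2
   + 5 + 8, from 8, k^2, [s] and 32kq^2b. *)
exists (k%:R ^+ 18) => G /card_gt0P[x _] /(_ x)[y xy].
set m := #|edges G|.
have m_gt0 : (0 < m)%N.
  by apply/card_gt0P; exists [set x; y]%SET; apply/imset2P; exists x y; rewrite ?inE.
(* Up to powers of k, [q] is about M, [b] about M^10, 32kq^2b about M^12 and its root [s] about M^6;
   the product that [N] must exceed is then about M^18. *)
pose M : R := m%:R `^ (1 / 20).
have MmR : M ^+ 20 = m%:R.
  rewrite -powR_mulrn ?powR_ge0 // -powRrM (_ : 1 / 20 * 20%:R = 1) ?powRr1 //.
  by field.
have M_ge1 : 1 <= M.
  by rewrite -(powRr0 (m%:R : R)); apply: ler_powR; [rewrite ler1n | lra].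
have M_gt0 : 0 < M by apply: lt_le_trans M_ge1.
set K : R := k%:R.
have K_ge n : 2 ^+ n <= K ^+ n by apply: lerXn2r; rewrite ?nnegrE ?ler0n ?ler_nat.
have K_ge0 n : 0 <= K ^+ n by rewrite exprn_ge0 ?ler0n.
have X_ge1 n : 1 <= M ^+ n by apply: exprn_ege1.
have X_ge0 n : 0 <= M ^+ n by apply: le_trans (X_ge1 n).
have trunc (z : R) : 0 <= z -> z <= (Num.truncn z).+1%:R <= z + 1.
  by move=> z0; have /andP[h1 /ltW->] := truncn_itv z0; rewrite -natr1 lerD2r.
pose q := Num.truncn M.
have /andP[qM Mq] := truncn_itv (ltW M_gt0).
have q_gt0 : (0 < q)%N by rewrite truncn_gt0.
pose b := (Num.truncn (2 * M ^+ 10)).+1.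
have /andP[Mb bM] := trunc (2 * M ^+ 10) (mulr_ge0 (ler0n _ 2) (X_ge0 10%N)).
have {}bM : b%:R <= 3 * M ^+ 10.
  by apply: le_trans bM _; move: (X_ge1 10%N); clear; lra.
pose s := (Num.truncn (K ^+ 4 * M ^+ 6)).+1.
have /andP[Ms sM] := trunc (K ^+ 4 * M ^+ 6) (mulr_ge0 (K_ge0 4%N) (X_ge0 6%N)).
have {}sM : s%:R <= K ^+ 5 * M ^+ 6.
  apply: le_trans sM _; rewrite [K ^+ 5]exprS -mulrA.
  have : 1 <= K ^+ 4 * M ^+ 6.
    rewrite -[1]mulr1; apply: ler_pM => //.
    by apply: le_trans (K_ge 4%N); rewrite -natrX ler1n.
  by move: (K_ge 1%N); rewrite !expr1; clear; nra.
have Ple : 32 * K * q%:R ^+ 2 * b%:R <= K ^+ 8 * M ^+ 12.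
  apply: (@le_trans _ _ (32 * K * M ^+ 2 * (3 * M ^+ 10))).
    apply: ler_pM => //; first by rewrite !mulr_ge0 ?exprn_ge0 ?ler0n.
    apply: ler_wpM2l; first by rewrite mulr_ge0 ?ler0n.
    by apply: lerXn2r; rewrite ?nnegrE ?ler0n ?(ltW M_gt0).
  have -> : 32 * K * M ^+ 2 * (3 * M ^+ 10) = 96 * (K * M ^+ 12) by ring.
  rewrite [K ^+ 8]exprSr -mulrA; apply: ler_wpM2r.
    by rewrite mulr_ge0 ?ler0n.
  by apply: le_trans (K_ge 7%N); rewrite -natrX ler_nat.
have PR : (32 * k * q ^ 2 * b)%:R = 32 * K * q%:R ^+ 2 * b%:R :> R.
  by rewrite 3!natrM natrX.
(* As m = M^20, the error term 2m k^18 m^(-1/20) equals 2Z. Its integer part [t] still exceeds Z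
   because Z >= 4. *)
pose Z := K ^+ 18 * M ^+ 19.
have Z_ge : 4 * M ^+ 19 <= Z.
  apply: ler_wpM2r => //; apply: le_trans (K_ge 18%N).
  apply: (@le_trans _ _ (2 ^+ 2)); first by rewrite -natrX.
  by apply: ler_weXn2l => //; rewrite ler1n.
pose t := Num.truncn (2 * Z).
have Z_ge0 : 0 <= Z := mulr_ge0 (K_ge0 18%N) (X_ge0 19%N).
have /andP[tM] := truncn_itv (mulr_ge0 (ler0n R 2) Z_ge0).
rewrite -natr1 => Mt.
have {}Mt : Z < t%:R by move: Z_ge Mt (X_ge1 19%N); rewrite -/t; clear; lra.
pose N := (2 * m + #|G| + t)%N.
apply: (@le_trans _ _ N%:R); last first.
  rewrite /N 2!natrD natrM powRN -/M -MmR mulrDr mulr1 addrAC lerD2r lerD2l.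
  rewrite (le_trans tM) // /Z exprS.
  have -> : 2 * (M * M ^+ 19) * (K ^+ 18 / M) = 2 * (K ^+ 18 * M ^+ 19) * (M / M).
    by rewrite !mulrA; ring.
  by rewrite divff ?mulr1 // lt0r_neq0.
rewrite ler_nat.
apply: (@ramsey_number_cycle_le k G q b s) => //.
- rewrite -(ler_nat R) natrM natrX -/m -MmR.
  apply: (@le_trans _ _ ((2 * M ^+ 10) ^+ 2)).
    by rewrite exprMn -exprM; apply: ler_wpM2r; rewrite // -natrX ler_nat.
  apply: lerXn2r => //; rewrite ?nnegrE ?ler0n //.
  exact: mulr_ge0 (ler0n _ 2) (X_ge0 10%N).
- rewrite -(ler_nat R) PR natrX; apply: le_trans Ple _.
  rewrite (exprM K 4 2) (exprM M 6 2) -exprMn.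
  apply: lerXn2r => //; rewrite ?nnegrE ?ler0n //.
  exact: mulr_ge0 (K_ge0 4%N) (X_ge0 6%N).
- rewrite -(ltr_nat R) /N 2!natrD natrM PR natrM natrM natrX -/K.
  apply: (@le_lt_trans _ _ Z); last first.
    by rewrite (lt_le_trans Mt) // lerDr addr_ge0 ?mulr_ge0 ?ler0n.
  apply: (@le_trans _ _ (K ^+ 18 * M ^+ 18)); last first.
    by apply: ler_wpM2l => //; apply: ler_weXn2l.
  have -> : K ^+ 18 * M ^+ 18 =
      K ^+ 3 * K ^+ 2 * (K ^+ 5 * M ^+ 6) * (K ^+ 8 * M ^+ 12) by ring.
  have K8 : 8 <= K ^+ 3 by apply: le_trans (K_ge 3%N); rewrite -natrX ler_nat.
  by do ![apply: ler_pM => //]; rewrite ?mulr_ge0 ?exprn_ge0 ?ler0n.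
(* What remains is 2m <= qt, which follows from t > 4 M^19 and M <= 2q. *)
- rewrite /N 2!mulnDr mulSn -/m -addnA addnC leq_add2l.
  rewrite -(ler_nat R) 2!natrM -MmR.
  apply: (@le_trans _ _ (q%:R * (4 * M ^+ 19))); last first.
    by apply: ler_wpM2l; rewrite ?ler0n // (le_trans Z_ge) // ltW.
  have : M <= 2 * q%:R.
    have : 1 <= q%:R :> R by rewrite ler1n.
    by move: Mq; rewrite -natr1 -/q; clear; lra.
  by rewrite exprS; move: (X_ge1 19%N); clear; nra.
Qed.
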